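(* Let $G$ be a finite group and let $A=\bigoplus_{g\in G}A_g$ be a strict $G$-crossed Frobenius $\star$-algebra. Let $r,s$ be non-negative integers and let $g_1,\dots,g_r,h_1,\dots,h_r,m_1,\dots,m_s\in G$ be such that $[g_1,h_1]\cdots[g_r,h_r]\cdot m_1\cdots m_s=1$, where $[g,h]=ghg^{-1}h^{-1}$. Let $G^\circ\le G$ be the subgroup generated by all the $g_i,h_i,m_j$. Let $a_j\in A_{m_j}$ for $1\le j\le s$. Then $$\lambda(\Omega_{g_1,h_1}\cdots\Omega_{g_r,h_r}\cdot a_1\cdots a_s)=\sum_{\chi\in\operatorname{Sim}(A_1)^{G^\circ}}\frac{\chi(\alpha_\chi)^{r-1}\,\chi^{m_1}(a_1)\cdots\chi^{m_s}(a_s)}{\phi_\chi(g_1,h_1,g_1^{-1},h_1^{-1},\dots,g_r,h_r,g_r^{-1},h_r^{-1},m_1,\dots,m_s)}.$$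
   Context: A Frobenius $\star$-algebra is a finite-dimensional associative unital $\mathbb{C}$-algebra $A$ with a linear functional $\lambda:A\to\mathbb{C}$ satisfying $\lambda(ab)=\lambda(ba)$ and a conjugate-linear involutive anti-automorphism $\star$ with $\lambda(a^\star)=\overline{\lambda(a)}$ such that the Hermitian form $\langle a,b\rangle=\lambda(ab^\star)$ is positive definite. A $G$-graded Frobenius $\star$-algebra is a $G$-graded algebra $A=\bigoplus_g A_g$ with such a structure $(\lambda,\star)$ where $\lambda$ vanishes on $A_g$ for $g\ne1$ and $(A_g)^\star=A_{g^{-1}}$. A $G$-crossed Frobenius $\star$-algebra is a $G$-graded Frobenius $\star$-algebra with an action of $G$ by algebra automorphisms preserving $\lambda$ and commuting with $\star$, such that $g(A_h)\subseteq A_{ghg^{-1}}$ and $ab=g(b)a$ for all $a\in A_g$, $b\in A$. Then $A_1$ is commutative; $\operatorname{Sim}(A_1)$ denotes the set of algebra homomorphisms $A_1\to\mathbb{C}$ (simple $A_1$-modules), on which $G$ acts by ${}^g\chi=\chi\circ g^{-1}$. There is also a partial action of $G$ given by ${}^gM=A_g\otimes_{A_1}M$ (zero or simple) for a simple $A_1$-module $M$. $A$ is strict if for every $g$ the fixed points of the partial action of $g$ coincide with the fixed points of $\chi\mapsto\chi\circ g^{-1}$; the common fixed point set is $\operatorname{Sim}(A_1)^g$. For a subgroup $H$, $\operatorname{Sim}(A_1)^H=\bigcap_{g\in H}\operatorname{Sim}(A_1)^g$, and $G_\chi=\{g:{}^g\chi=\chi\}$. Twisted characters: for $\chi\in\operatorname{Sim}(A_1)^g$,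 $\chi$ extends to an algebra homomorphism $\widetilde\chi:A_{\langle g\rangle}=\bigoplus_{k\in\langle g\rangle}A_k\to\mathbb{C}$ in exactly $o(g)$ ways, whose restrictions to $A_g$ differ by $o(g)$-th roots of unity; a choice of extension is fixed and $\chi^g:=\widetilde\chi|_{A_g}:A_g\to\mathbb{C}$ is the $g$-twisted character ($\chi^1=\chi$). Choices are made so that $\chi^g(a)\chi^{g^{-1}}(b)=\chi(ab)$ for $a\in A_g$, $b\in A_{g^{-1}}$. $\alpha_\chi\in A_1$ is the element with $\lambda(x\alpha_\chi)=\chi(x)$ for all $x\in A_1$. For $g_1,\dots,g_n\in G_\chi$, $\phi_\chi(g_1,\dots,g_n)\in\mathbb{C}^\times$ is the scalar with $$\chi^{g_1}(a_1)\cdots\chi^{g_n}(a_n)=\phi_\chi(g_1,\dots,g_n)\,\chi^{g_1\cdots g_n}(a_1\cdots a_n)\quad\text{for all }a_i\in A_{g_i}$$ (equal to $1$ when $n=0$). For $g,h\in G$, $\Omega_{g,h}:=\sum_{x\in P_g}x\cdot h(x^\star)\in A_{ghg^{-1}h^{-1}}$, where $P_g$ is any orthonormal basis of $A_g$ for $\langle\cdot,\cdot\rangle$; it is independent of the choice of basis. *)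

(* Defs.v *)
From HB Require Import structures.
From mathcomp Require Import all_boot all_order all_algebra all_fingroup.
From mathcomp Require Import falgebra complex.
From mathcomp Require Import boolp classical_sets cardinality fsbigop reals.

Set Implicit Arguments.
Unset Strict Implicit.
Unset Printing Implicit Defensive.

Import Order.TTheory GRing.Theory Num.Theory.

Local Open Scope classical_set_scope.
Local Open Scope ring_scope.
Local Open Scope complex_scope.

Section CrossedFrobenius.

Variables (R : realType) (gT : finGroupType) (A : falgType R[i]).

Record frobenius_star := FrobeniusStar {
  lambda : 'Hom(A, R[i]^o);
  star : A -> A;
  lambdaC : forall a b, lambda (a * b) = lambda (b * a);
  star_semilinear : forall (c : R[i]) a b,
    star (c *: a + b) = Num.conj c *: star a + star b;
  starM : forall a b, star (a * b) = star b * star a;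
  starK : involutive star;
  lambda_star : forall a, lambda (star a) = Num.conj (lambda a : R[i]);
  (* the order of R[i]: 0 < z means that z is real and positive *)
  lambda_pos : forall a, a != 0 -> 0 < (lambda (a * star a) : R[i])
}.

Record grading := Grading {
  grade : gT -> {vspace A};
  grade_full : (\sum_g grade g)%VS = fullv;
  grade_direct : directv (\sum_g grade g)%VS;
  grade1 : 1 \in grade 1%g;
  gradeM : forall g h a b,
    a \in grade g -> b \in grade h -> a * b \in grade (g * h)%g
}.

Record graded_frobenius_star := GradedFrobeniusStar {
  gfs_frobenius :> frobenius_star;
  gfs_grading :> grading;
  lambda_grade : forall g a,
    g != 1%g -> a \in grade gfs_grading g -> lambda gfs_frobenius a = 0;
  star_grade : forall g a,
    (star gfs_frobenius a \in grade gfs_grading g^-1%g)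
    = (a \in grade gfs_grading g)
}.

Record crossed_frobenius_star := CrossedFrobeniusStar {
  cfs_graded :> graded_frobenius_star;
  crossed_act : gT -> 'AEnd(A);
  act1 : forall a, crossed_act 1%g a = a;
  actM : forall g h a, crossed_act (g * h)%g a = crossed_act g (crossed_act h a);
  act_lambda : forall g a, lambda cfs_graded (crossed_act g a) = lambda cfs_graded a;
  act_star : forall g a, crossed_act g (star cfs_graded a) = star cfs_graded (crossed_act g a);
  (* in fingroup, h ^ g^-1 is the conjugate g * h * g^-1 *)
  act_grade : forall g h a,
    a \in grade cfs_graded h -> crossed_act g a \in grade cfs_graded (h ^ g^-1)%g;
  crossedC : forall g a b,
    a \in grade cfs_graded g -> a * b = crossed_act g b * a
}.

Variable X : crossed_frobenius_star.
Implicit Types (g h : gT) (H : {group gT}).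

Fact grade_sum_is_aspace H : is_aspace (\sum_(k in H) grade X k)%VS.
Proof.
have sub1 k : k \in H -> (grade X k <= \sum_(k in H) grade X k)%VS.
  by move=> Hk; apply: (sumv_sup k).
rewrite /is_aspace has_algid1 /=; last first.
  exact: subvP (sub1 _ (group1 H)) _ (grade1 X).
rewrite big_distrlr /=; apply/subv_sumP => g Hg; apply/subv_sumP => h Hh.
apply/prodvP => a b Aa Ab.
exact: subvP (sub1 _ (groupM Hg Hh)) _ (gradeM Aa Ab).
Qed.

Definition grade_sum H : {aspace A} := ASpace (grade_sum_is_aspace H).

Fact grade1_is_aspace : is_aspace (grade X 1%g).
Proof.
rewrite /is_aspace has_algid1 ?grade1 //=; apply/prodvP => a b Aa Ab.
by rewrite -(mulg1 1%g); apply: gradeM.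
Qed.

Definition neutral : {aspace A} := ASpace grade1_is_aspace.

Definition Sim := 'AHom(subvs_of neutral, R[i]^o).

Definition act_neutral_fun g (x : subvs_of neutral) : subvs_of neutral :=
  vsproj neutral (crossed_act X g (vsval x)).

Fact act_neutral_fun_linear g : linear (act_neutral_fun g).
Proof. by move=> c x y; rewrite /act_neutral_fun !linearP. Qed.

HB.instance Definition _ g :=
  GRing.isLinear.Build R[i] (subvs_of neutral) (subvs_of neutral) *:%R
    (act_neutral_fun g) (act_neutral_fun_linear g).

Fact act_neutral_in g (x : subvs_of neutral) :
  crossed_act X g (vsval x) \in neutral.
Proof. by have := act_grade g (subvsP x); rewrite conj1g. Qed.

Fact act_neutral_is_ahom g : ahom_in fullv (linfun (act_neutral_fun g)).
Proof.
have N1 : algid neutral = 1 by apply/eqP; rewrite algid_eq1 grade1.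
apply/ahom_inP; split=> [x y _ _|]; last first.
  by rewrite lfunE; apply: val_inj; rewrite /= vsprojK /= N1 rmorph1 ?grade1.
by rewrite !lfunE; apply: val_inj; rewrite /= !vsprojK ?act_neutral_in ?rmorphM.
Qed.

Definition act_neutral g : 'AEnd(subvs_of neutral) :=
  AHom (act_neutral_is_ahom g).

Definition sim_act g (chi : Sim) : Sim := comp_ahom chi (act_neutral g^-1%g).

Definition sim_fix (H : {set gT}) : set Sim :=
  [set chi | forall g, g \in H -> sim_act g chi = chi].

Definition lmul_grade g (x : subvs_of neutral) (a : subvs_of (grade X g)) :=
  vsproj (grade X g) (vsval x * vsval a).

Definition rmul_grade g (a : subvs_of (grade X g)) (x : subvs_of neutral) :=
  vsproj (grade X g) (vsval a * vsval x).

Definition balanced g (M : lmodType R[i]) (rho : subvs_of neutral -> M -> M)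
    (V : lmodType R[i]) (f : subvs_of (grade X g) -> M -> V) : Prop :=
  [/\ forall m, linear (f^~ m),
      forall a, linear (f a)
    & forall a x m, f (rmul_grade a x) m = f a (rho x m)].

(* universal property of A_g (x)_{A_1} M, where A_1 acts on M by rho *)
Definition is_tensor g (M : lmodType R[i]) (rho : subvs_of neutral -> M -> M)
    (T : lmodType R[i]) (beta : subvs_of (grade X g) -> M -> T) : Prop :=
  balanced rho beta /\
  forall (V : lmodType R[i]) (f : subvs_of (grade X g) -> M -> V),
    balanced rho f ->
    exists h : {linear T -> V},
      (forall a m, h (beta a m) = f a m) /\
      (forall h' : {linear T -> V},
         (forall a m, h' (beta a m) = f a m) -> h' =1 h).

Definition sim_module (chi : Sim) (x : subvs_of neutral) (m : R[i]^o) :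
  R[i]^o := chi x * m.

(* A_g (x)_{A_1} C_chi is isomorphic to C_chi' as an A_1-module *)
Definition partial_act g (chi chi' : Sim) : Prop :=
  exists beta : subvs_of (grade X g) -> R[i]^o -> R[i]^o,
    is_tensor (sim_module chi) beta /\
    forall x a m, beta (lmul_grade x a) m = sim_module chi' x (beta a m).

Definition strict : Prop :=
  forall g (chi : Sim), partial_act g chi chi <-> sim_act g chi = chi.

Definition tw_val
    (ext : Sim -> forall g, 'Hom(subvs_of (grade_sum <[g]>), R[i]^o))
    (chi : Sim) g (a : A) : R[i] :=
  ext chi g (vsproj (grade_sum <[g]>) a).

(* The value of tw_ext chi g matters only when g fixes chi: otherwise there
   need not be any algebra morphism from A_<g> to C. *)
Record twisted_choice := TwistedChoice {
  tw_ext : Sim -> forall g, 'Hom(subvs_of (grade_sum <[g]>), R[i]^o);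
  tw_ahom : forall chi g, sim_act g chi = chi -> ahom_in fullv (tw_ext chi g);
  tw_extends : forall chi g, sim_act g chi = chi ->
    forall x : subvs_of neutral, tw_val tw_ext chi g (vsval x) = chi x;
  tw_inv : forall chi g, sim_act g chi = chi ->
    forall a b, a \in grade X g -> b \in grade X g^-1%g ->
    tw_val tw_ext chi g a * tw_val tw_ext chi g^-1%g b
    = chi (vsproj neutral (a * b))
}.

(* chi^g; meaningful for a in A_g and g fixing chi *)
Definition twisted_char (tw : twisted_choice) (chi : Sim) g (a : A) : R[i] :=
  tw_val (tw_ext tw) chi g a.

Definition alpha_chi (chi : Sim) : subvs_of neutral :=
  xget 0 [set y | forall x : subvs_of neutral,
    lambda X (vsval x * vsval y) = chi x].

(* A list s of pairs (g_i, a_i) encodes the choice of a_i in A_(g_i). *)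
Definition phi_chi (tw : twisted_choice) (chi : Sim) (gs : seq gT) : R[i] :=
  xget 1 [set c | c != 0 /\
    forall s : seq (gT * A), [seq p.1 | p <- s] = gs ->
      (forall p, p \in s -> p.2 \in grade X p.1) ->
      \prod_(p <- s) twisted_char tw chi p.1 p.2
      = c * twisted_char tw chi (\prod_(p <- s) p.1)%g (\prod_(p <- s) p.2)].

Definition orthonormal_basis (U : {vspace A}) (P : seq A) : Prop :=
  basis_of U P /\
  forall i j, (i < size P)%N -> (j < size P)%N ->
    lambda X (P`_i * star X P`_j) = (i == j)%:R.

Definition Omega_gh (P : gT -> seq A) g h : A :=
  \sum_(x <- P g) x * crossed_act X h (star X x).

End CrossedFrobenius.

Arguments sim_fix {R gT A} X H _.

(* [g, h] = g h g^-1 h^-1; fingroup's [~ g, h] is g^-1 h^-1 g h instead *)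
Definition comm_gh (gT : finGroupType) (g h : gT) : gT :=
  (g * h * g^-1 * h^-1)%g.

(* Main.v *)
(* The neutral component A_1 is central in A and, by positivity of the form,
   commutative semisimple: by Riesz duality every character chi has a dual
   element alpha_chi, a multiple of a primitive idempotent e_chi, and the e_chi
   sum to 1.  Hence lambda(y) is the sum of chi(y) / chi(alpha_chi) on A_1, and
   it suffices to compute the e_chi-component of the product.  If g moves chi,
   then A_g e_chi = 0; otherwise strictness makes A_g e_chi a line C u_g with
   a e_chi = chi^g(a) u_g.  The functional chi^g on A_g is dual to
   chi(alpha_chi) u_(g^-1), which gives
     Omega_(g,h) e_chi = chi(alpha_chi) u_g h(u_(g^-1)),
   that is, chi(alpha_chi) u_g u_h u_(g^-1) u_(h^-1) if h fixes chi, and 0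
   otherwise; and phi_chi(g_1, ..., g_n) is the inverse of the scalar c with
   u_(g_1) ... u_(g_n) = c u_(g_1 ... g_n). *)
Require Import Defs.
From HB Require Import structures.
From mathcomp Require Import all_boot all_order all_algebra all_fingroup.
From mathcomp Require Import falgebra complex.
From mathcomp Require Import boolp classical_sets cardinality fsbigop reals.

Set Implicit Arguments.
Unset Strict Implicit.
Unset Printing Implicit Defensive.

Import Order.TTheory GRing.Theory Num.Theory.

Local Open Scope classical_set_scope.
Local Open Scope ring_scope.
Local Open Scope complex_scope.

(** * Linear algebra: common eigenvectors of commuting elements over a closed field *)

Lemma scaler_injl (F : fieldType) (V : lmodType F) (v : V) :
  v != 0 -> injective ( *:%R^~ v).
Proof.
move=> v0 c d /eqP; rewrite -subr_eq0 -scalerBl scaler_eq0 (negbTE v0) orbF.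
by rewrite subr_eq0 => /eqP.
Qed.

Lemma big_enum_type (I : finType) (T : Type) (idx : T) (op : T -> T -> T)
    (F : I -> T) :
  \big[op/idx]_(i <- enum I) F i = \big[op/idx]_(i : I) F i.
Proof. by rewrite enumT; congr bigop; rewrite unlock. Qed.

(** One more power of [x] than the dimension of [A] cannot be linearly independent. *)
Lemma annihilating_poly (F : fieldType) (A : falgType F) (x : A) :
  exists2 p : {poly F}, p != 0 & horner_alg x p = 0.
Proof.
pose n := (\dim {:A}).+1; pose S := [tuple x ^+ i | i < n].
have notfree : ~~ free S.
  rewrite /free neq_ltn size_tuple.
  by apply/orP; left; rewrite ltnS dimvS ?subvf.
apply: contrapT => nop; move/negP: notfree; apply; apply/freeP => k k0 i.
apply: contrapT => /eqP ki; apply: nop.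
pose kk (j : nat) : F := if insub j is Some j' then k j' else 0.
have kkE (j : 'I_n) : kk j = k j.
  by rewrite /kk insubT //= => lt; congr k; apply: val_inj.
exists (\poly_(j < n) kk j).
  apply: contraNneq ki => p0; have := coef_poly n kk i.
  by rewrite p0 coef0 ltn_ord kkE => <-.
rewrite poly_def linear_sum -[RHS]k0; apply: eq_bigr => j _.
rewrite linearZ /= rmorphXn /= horner_algX kkE (nth_map j) ?size_enum_ord //.
by rewrite nth_ord_enum mulr_algl.
Qed.

(** Apply the linear factors of an annihilating polynomial of [x] to [v] one at a time: the last
    vector before 0 is an eigenvector. *)
Lemma eigenvector_in_stable (F : closedFieldType) (A : falgType F) (x v : A)
    (I : {vspace A}) :
  (forall u, u \in I -> x * u \in I) -> v \in I -> v != 0 ->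
  exists2 w, w \in I & w != 0 /\ exists c : F, x * w = c *: w.
Proof.
move=> xI vI v0; have [p p0 xp] := annihilating_poly x.
have [r pE] := closed_field_poly_normal p.
have : horner_alg x (\prod_(z <- r) ('X - z%:P)) * v = 0.
  move/eqP: xp; rewrite {}pE linearZ /= mulr_algl scaler_eq0 lead_coef_eq0.
  by rewrite (negbTE p0) /= => /eqP ->; rewrite mul0r.
elim: r v vI v0 {pE} => [|z r IH] v vI v0.
  by rewrite big_nil rmorph1 mul1r => /eqP; rewrite (negbTE v0).
rewrite big_cons mulrC rmorphM -mulrA rmorphB /= horner_algX horner_algC.
rewrite [X in _ * X]mulrBl mulr_algl.
have [/eqP xv _ | xv] := eqVneq (x * v - z *: v) 0.
  by exists v => //; split=> //; exists z; apply/eqP; rewrite -subr_eq0.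
by apply: IH => //; rewrite memvB ?memvZ ?xI.
Qed.

(** Induction on [\dim I]: if some [x] in [B] does not scale the picked [v], an eigenspace [K] of
    [x] in [I] is nonzero, misses [v], and is stable under [B] by commutativity. *)
Lemma common_eigenvector_in (F : closedFieldType) (A : falgType F)
    (B I : {vspace A}) :
  (forall x y, x \in B -> y \in B -> x * y = y * x) ->
  (forall x u, x \in B -> u \in I -> x * u \in I) -> I != 0%VS ->
  exists2 v, v \in I &
    v != 0 /\ forall x, x \in B -> exists c : F, x * v = c *: v.
Proof.
move=> Bcomm; have [n] := ubnP (\dim I).
elim: n I => // n IH I; rewrite ltnS => dimI BI I0.
pose v := vpick I; have vI : v \in I by apply: memv_pick.
have v0 : v != 0 by rewrite vpick0.
case: (pselect (exists2 x, x \in B & ~ exists c : F, x * v = c *: v));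
  last first.
  move=> nx; exists v => //; split=> // x xB; apply: contrapT => nc.
  by apply: nx; exists x.
case=> x xB nc.
have [w wI [w0 [c xw]]] := eigenvector_in_stable (BI x ^~ xB) vI v0.
pose K := (I :&: lker (amull x - c *: @id_lfun F A))%VS.
have KE u : (u \in K) = (u \in I) && (x * u == c *: u).
  rewrite memv_cap memv_ker add_lfunE opp_lfunE scale_lfunE id_lfunE lfunE /=.
  by rewrite subr_eq0.
have ltK : (\dim K < n)%N.
  apply: leq_trans dimI; rewrite (ltn_leqif (dimv_leqif_eq (capvSl _ _))).
  apply/eqP => KI; have := vI; rewrite -KI KE => /andP[_ /eqP xv].
  by apply: nc; exists c.
have BK y u : y \in B -> u \in K -> y * u \in K.
  move=> yB; rewrite !KE => /andP[uI /eqP xu]; rewrite BI //= mulrA.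
  by rewrite (Bcomm _ _ xB yB) -mulrA xu scalerAr.
have K0 : K != 0%VS.
  apply: contraNneq w0 => K0; rewrite -memv0 -K0 KE wI xw; exact: eqxx.
have [u uK [u0 eigu]] := IH K ltK BK K0.
by exists u => //; move: uK; rewrite KE => /andP[].
Qed.

(** * The trace form, the star and the neutral component *)

Section PrincipalComponent.

Variables (R : realType) (gT : finGroupType) (A : falgType R[i]).
Variable X : crossed_frobenius_star gT A.
Implicit Types (g h : gT) (a b x y z : A) (chi : Sim X).

Local Notation star := (star X).
Local Notation A_ := (grade X).

Definition lam a : R[i] := lambda X a.

Lemma lamP (c : R[i]) a b : lam (c *: a + b) = c * lam a + lam b.
Proof. by rewrite /lam linearP. Qed.

Lemma lamZ (c : R[i]) a : lam (c *: a) = c * lam a.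
Proof. by rewrite /lam linearZ. Qed.

Lemma lam_sum I (r : seq I) (F : I -> A) :
  lam (\sum_(i <- r) F i) = \sum_(i <- r) lam (F i).
Proof. by rewrite /lam linear_sum. Qed.

Lemma mul_star_eq0 a : a * star a = 0 -> a = 0.
Proof.
move=> a0; apply/eqP; apply: contraT => /(lambda_pos X).
by rewrite a0 linear0 ltxx.
Qed.

Lemma star_mul_eq0 a : star a * a = 0 -> a = 0.
Proof.
move=> a0; apply/eqP; apply: contraT => /(lambda_pos X).
by rewrite lambdaC a0 linear0 ltxx.
Qed.

Lemma star_gradeV g a : a \in A_ g -> star a \in A_ g^-1%g.
Proof. by rewrite star_grade. Qed.

Lemma star_neutral a : a \in A_ 1%g -> star a \in A_ 1%g.
Proof. by move/star_gradeV; rewrite invg1. Qed.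

Lemma mulgr1 x y : x \in A_ 1%g -> y \in A_ 1%g -> x * y \in A_ 1%g.
Proof. by move=> x1 y1; rewrite -(mulg1 1%g); apply: gradeM. Qed.

Lemma neutral_central x b : x \in A_ 1%g -> x * b = b * x.
Proof. by move=> x1; rewrite (crossedC b x1) Defs.act1. Qed.

(** Positivity is applied twice: for central [x] with square 0, the self-adjoint [w = x * star x]
    also has square 0, so [w] and then [x] vanish. *)
Lemma neutral_reduced x : x \in A_ 1%g -> x * x = 0 -> x = 0.
Proof.
move=> x1 xx; have sx1 := star_neutral x1.
apply: mul_star_eq0; set w := x * star x.
have w_sa : star w = w by rewrite /w starM starK.
apply: mul_star_eq0; rewrite w_sa /w -mulrA (mulrA (star x)).
by rewrite (neutral_central x sx1) !mulrA xx !mul0r.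
Qed.

Lemma lam_nondegenerate g z :
  z \in A_ g^-1%g -> (forall y, y \in A_ g -> lam (y * z) = 0) -> z = 0.
Proof.
move=> zg y0; apply: star_mul_eq0; apply/eqP; apply: contraT => nz.
have: z != 0 by apply: contra_neq nz => ->; rewrite mulr0.
move/(lambda_pos X); rewrite lambdaC.
suff /y0 : star z \in A_ g by rewrite /lam => ->; rewrite ltxx.
by rewrite -(invgK g) star_grade.
Qed.

Lemma dual_basis_sum_in g (P : seq A) (f : A -> R[i]) :
  orthonormal_basis X (A_ g) P ->
  \sum_(x <- P) f x *: star x \in A_ g^-1%g.
Proof.
case=> bP _; rewrite big_seq; apply: memv_suml => x xP; apply: memvZ.
by apply: star_gradeV; apply: (basis_mem bP).
Qed.

(** Riesz duality: by orthonormality, pairing a basis vector with the sum leaves only the value of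
    [f] there. *)
Lemma lam_dual_basis_sum g (P : seq A) (f : A -> R[i]) :
  orthonormal_basis X (A_ g) P ->
  (forall c a b, f (c *: a + b) = c * f a + f b) ->
  forall y, y \in A_ g -> lam (y * \sum_(x <- P) f x *: star x) = f y.
Proof.
case=> bP oP f_lin y yg.
have f0 : f 0 = 0.
  by have := f_lin (-1) 0 0; rewrite scaler0 addr0 mulN1r addNr.
pose k := coord (in_tuple P).
have -> : y = \sum_(i < size P) k i y *: P`_i.
  by apply: coord_span; rewrite (span_basis bP).
have f_sum :
    f (\sum_(i < size P) k i y *: P`_i) = \sum_(i < size P) k i y * f P`_i.
  elim: (index_enum _) => [|i r IH]; first by rewrite !big_nil f0.
  by rewrite !big_cons f_lin IH.
rewrite f_sum mulr_suml lam_sum; apply: eq_bigr => j _.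
rewrite -scalerAl lamZ; congr (_ * _).
rewrite (big_nth 0) big_mkord mulr_sumr lam_sum (bigD1 j) //=.
rewrite -scalerAr lamZ {1}/lam (oP j j) // eqxx mulr1 big1 ?addr0 // => i ij.
rewrite -scalerAr lamZ {1}/lam (oP j i) // eq_sym.
by rewrite -(inj_eq val_inj) in ij; rewrite (negbTE ij) mulr0.
Qed.

(** The projection onto [A_1] makes [chi] a linear function on all of [A]; it is multiplicative on
    [A_1]. *)
Definition sim_val chi a : R[i] := chi (vsproj (neutral X) a).

Lemma sim_valP chi (c : R[i]) a b :
  sim_val chi (c *: a + b) = c * sim_val chi a + sim_val chi b.
Proof. by rewrite /sim_val !linearP. Qed.

Lemma sim_valZ chi (c : R[i]) a : sim_val chi (c *: a) = c * sim_val chi a.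
Proof. by rewrite /sim_val !linearZ. Qed.

Lemma sim_val0 chi : sim_val chi 0 = 0.
Proof. by rewrite /sim_val !linear0. Qed.

Lemma sim_valB chi a b : sim_val chi (a - b) = sim_val chi a - sim_val chi b.
Proof. by rewrite /sim_val !linearB. Qed.

Lemma sim_val_sum chi I (r : seq I) (F : I -> A) :
  sim_val chi (\sum_(i <- r) F i) = \sum_(i <- r) sim_val chi (F i).
Proof. by rewrite /sim_val !linear_sum. Qed.

Lemma algid_neutral : algid (neutral X) = 1.
Proof. by apply/eqP; rewrite algid_eq1 grade1. Qed.

Lemma vsproj_neutralM x y : x \in A_ 1%g -> y \in A_ 1%g ->
  vsproj (neutral X) (x * y) = vsproj (neutral X) x * vsproj (neutral X) y.
Proof.
by move=> x1 y1; apply: val_inj; rewrite /= !vsprojK //= mulgr1.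
Qed.

Lemma sim_val1 chi : sim_val chi 1 = 1.
Proof.
rewrite -[RHS](rmorph1 chi).
congr (chi _); apply: val_inj; rewrite /= vsprojK ?algid_neutral //=.
exact: grade1.
Qed.

Lemma sim_valM chi x y : x \in A_ 1%g -> y \in A_ 1%g ->
  sim_val chi (x * y) = sim_val chi x * sim_val chi y.
Proof. by move=> x1 y1; rewrite /sim_val vsproj_neutralM // rmorphM. Qed.

Lemma sim_eq chi chi' :
  (forall x, x \in A_ 1%g -> sim_val chi x = sim_val chi' x) -> chi = chi'.
Proof.
move=> eq1; apply/val_inj/lfunP => x.
by have := eq1 _ (subvsP x); rewrite /sim_val vsvalK.
Qed.

(** The eigenvalue of [x] on [v] is [lam (x * (v * star v)) / lam (v * star v)], which is visibly
    linear in [x]; multiplicativity follows by comparing coefficients of [v]. *)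
Lemma eigenvector_sim v : v \in A_ 1%g -> v != 0 ->
  (forall x, x \in A_ 1%g -> exists c : R[i], x * v = c *: v) ->
  exists chi, forall x, x \in A_ 1%g -> x * v = sim_val chi x *: v.
Proof.
move=> v1 v0 eigv.
have n0 : lam (v * star v) != 0 by rewrite gt_eqF ?(lambda_pos X).
pose f : 'Hom(subvs_of (neutral X), R[i]^o) :=
  ((lam (v * star v))^-1 *:
     (lambda X \o (amulr (v * star v) \o linfun vsval)))%VF.
have fE (x : subvs_of (neutral X)) : vsval x * v = (f x : R[i]) *: v.
  have [c xv] := eigv _ (subvsP x).
  have -> : (f x : R[i]) = (lam (v * star v))^-1 * lam (vsval x * (v * star v)).
    rewrite /f lfunE /= !lfunE /= /lam !lfunE /= lfunE /= lfunE /=. by [].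
  by rewrite mulrA xv -scalerAl lamZ mulrCA mulVf ?mulr1.
have ahom_f : ahom_in fullv f.
  apply/ahom_inP; split=> [x y _ _|].
    apply: (scaler_injl v0); rewrite -fE /= -mulrA fE -scalerAr fE scalerA.
    by congr (_ *: _); rewrite mulrC.
  apply: (scaler_injl v0); rewrite -fE /= algid_neutral mul1r.
  by rewrite [RHS]scale1r.
exists (AHom ahom_f) => x x1.
by rewrite /sim_val /= -fE vsprojK.
Qed.

(** * The dual elements [alpha_chi] and the primitive idempotents of [A_1] *)

Variables (P : gT -> seq A)
  (onP : forall g, orthonormal_basis X (A_ g) (P g)).

(** The Riesz representative of [chi] on [A_1] witnesses that the choice by [xget] is not the
    default 0. *)
Lemma lam_alpha chi x : x \in A_ 1%g ->
  lam (x * vsval (alpha_chi chi)) = sim_val chi x.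
Proof.
move=> x1; pose dual (y : subvs_of (neutral X)) :=
  forall u : subvs_of (neutral X), lambda X (vsval u * vsval y) = chi u.
suff : dual (alpha_chi chi).
  by move/(_ (vsproj (neutral X) x)); rewrite vsprojK.
apply: (xgetPex 0).
exists (vsproj (neutral X) (\sum_(a <- P 1%g) sim_val chi a *: star a)) => u.
have dual1 := dual_basis_sum_in (sim_val chi) (onP 1%g).
rewrite invg1 in dual1; rewrite vsprojK //.
have /= := lam_dual_basis_sum (onP 1%g) (sim_valP chi) (subvsP u).
by rewrite /lam /sim_val vsvalK.
Qed.

Lemma alpha_neutral chi : vsval (alpha_chi chi) \in A_ 1%g.
Proof. exact: subvsP (alpha_chi chi). Qed.

(** Both sides pair with [y] in [A_1] to [chi(y) chi(x)], and the pairing is nondegenerate. *)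
Lemma alpha_eigen chi x : x \in A_ 1%g ->
  x * vsval (alpha_chi chi) = sim_val chi x *: vsval (alpha_chi chi).
Proof.
move=> x1; set al := vsval _; have al1 : al \in A_ 1%g := alpha_neutral chi.
apply/eqP; rewrite -subr_eq0; apply/eqP.
apply: (@lam_nondegenerate 1%g).
  by rewrite invg1 memvB ?mulgr1 ?memvZ.
move=> y y1; rewrite mulrBr -scalerAr mulrA addrC -scaleNr lamP.
rewrite !lam_alpha ?mulgr1 // sim_valM //.
by rewrite mulNr mulrC addNr.
Qed.

Lemma alpha_neq0 chi : vsval (alpha_chi chi) != 0.
Proof.
apply/eqP => al0; have := lam_alpha chi (grade1 X).
by rewrite al0 mulr0 /lam linear0 sim_val1 => /esym/eqP; rewrite oner_eq0.
Qed.

(** The square of [alpha_chi] is [chi(alpha_chi)] times itself; a zero scalar would make it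
    nilpotent in the reduced algebra [A_1]. *)
Lemma sim_alpha_neq0 chi : sim_val chi (vsval (alpha_chi chi)) != 0.
Proof.
apply: contra_neq (alpha_neq0 chi) => sal0.
apply: neutral_reduced; first exact: alpha_neutral.
by rewrite alpha_eigen ?alpha_neutral // sal0 scale0r.
Qed.

Definition idem chi : A :=
  (sim_val chi (vsval (alpha_chi chi)))^-1 *: vsval (alpha_chi chi).

Lemma idem_neutral chi : idem chi \in A_ 1%g.
Proof. by rewrite memvZ ?alpha_neutral. Qed.

Lemma mulr_idem chi x : x \in A_ 1%g ->
  x * idem chi = sim_val chi x *: idem chi.
Proof.
by move=> x1; rewrite /idem -scalerAr alpha_eigen // !scalerA mulrC.
Qed.

Lemma sim_val_idem chi : sim_val chi (idem chi) = 1.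
Proof. by rewrite /idem sim_valZ mulVf ?sim_alpha_neq0. Qed.

Lemma idem_id chi : idem chi * idem chi = idem chi.
Proof. by rewrite mulr_idem ?idem_neutral // sim_val_idem scale1r. Qed.

Lemma idem_neq0 chi : idem chi != 0.
Proof. by rewrite scaler_eq0 invr_eq0 negb_or sim_alpha_neq0 alpha_neq0. Qed.

Lemma lam_idem chi : lam (idem chi) = (sim_val chi (vsval (alpha_chi chi)))^-1.
Proof.
rewrite /idem lamZ -[vsval (alpha_chi chi) in X in _ * X]mul1r.
by rewrite lam_alpha ?grade1 // sim_val1 mulr1.
Qed.

(** Applying [chi'] to [x * idem chi = chi(x) *: idem chi] shows that a nonzero [chi'(idem chi)]
    could be cancelled, forcing [chi = chi']. *)
Lemma sim_val_idem_neq chi chi' : chi != chi' -> sim_val chi' (idem chi) = 0.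
Proof.
apply: contra_neq_eq => e0; apply: sim_eq => x x1; apply: (mulIf e0).
by rewrite -sim_valM ?idem_neutral // mulr_idem // sim_valZ.
Qed.

Lemma idem_central chi b : idem chi * b = b * idem chi.
Proof. exact: neutral_central (idem_neutral chi). Qed.

(** The idempotents of distinct characters are dual to these characters, hence linearly
    independent. *)
Lemma uniq_sims_leq_dim (s : seq (Sim X)) : uniq s -> (size s <= \dim {:A})%N.
Proof.
move=> us; pose S := map_tuple idem (in_tuple s).
suff : free S.
  by rewrite /free size_tuple => /eqP <-; rewrite dimvS ?subvf.
apply/freeP => k k0 i; pose chi := tnth (in_tuple s) i.
have := congr1 (sim_val chi) k0; rewrite sim_val0 sim_val_sum => <-.
have SE (j : 'I_(size s)) : S`_j = idem (tnth (in_tuple s) j).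
  by rewrite -tnth_nth tnth_map.
rewrite (bigD1 i) //= SE sim_valZ sim_val_idem mulr1 big1 ?addr0 // => j ji.
rewrite SE sim_valZ sim_val_idem_neq ?mulr0 //.
have chi0 := chi; rewrite /chi !(tnth_nth chi0) /= nth_uniq //.
Qed.

(** A duplicate-free list of maximal length, which exists by the dimension bound, must contain every
    character. *)
Lemma sim_enumeration : exists2 s : seq (Sim X),
  uniq s & forall chi, chi \in s.
Proof.
pose Q n := `[< exists2 s : seq (Sim X), uniq s & size s = n >].
have exQ : exists n, Q n by exists 0%N; apply/asboolP; exists [::].
have ubQ n : Q n -> (n <= \dim {:A})%N.
  by move/asboolP => [s us <-]; apply: uniq_sims_leq_dim.
case: (ex_maxnP exQ ubQ) => n /asboolP[s us sn] max_n.
exists s => // chi; apply: contraT => chis.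
have : Q n.+1 by apply/asboolP; exists (chi :: s); rewrite /= ?chis ?sn.
by move/max_n; rewrite ltnn.
Qed.

(** The defect [f] is an idempotent killed by every character. Were it nonzero, its ideal would
    contain a common eigenvector [v] of [A_1], whose character gives
    [v = f * v = chi(f) *: v = 0]. *)
Lemma sum_idem (s : seq (Sim X)) : uniq s -> (forall chi, chi \in s) ->
  \sum_(chi <- s) idem chi = 1.
Proof.
move=> us s_all; set e := \sum_(_ <- s) _; pose f := 1 - e.
have e1 : e \in A_ 1%g by apply: memv_suml => chi _; apply: idem_neutral.
have f1 : f \in A_ 1%g by rewrite memvB ?grade1.
have chi_f chi : sim_val chi f = 0.
  rewrite sim_valB sim_val1 sim_val_sum (bigD1_seq chi) //= sim_val_idem.
  by rewrite big1 ?addr0 ?subrr // => chi' /sim_val_idem_neq.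
have ff : f * f = f.
  rewrite {2}/f mulrBr mulr1 mulr_sumr big1 ?subr0 // => chi _.
  by rewrite mulr_idem // chi_f scale0r.
apply/eqP; rewrite eq_sym -subr_eq0 -/f; apply: contraT => f0.
(* The ideal generated by [f] in [A_1], described as the fixed space of multiplication by [f]. *)
pose I := (A_ 1%g :&: lker (amulr f - @id_lfun _ A))%VS.
have IE u : (u \in I) = (u \in A_ 1%g) && (u * f == u).
  rewrite memv_cap memv_ker add_lfunE opp_lfunE id_lfunE lfunE /=.
  by rewrite subr_eq0.
have I0 : I != 0%VS.
  by apply: contra_neq f0 => I0; apply/eqP; rewrite -memv0 -I0 IE f1 ff eqxx.
have BI x u : x \in A_ 1%g -> u \in I -> x * u \in I.
  by move=> x1; rewrite !IE => /andP[u1 /eqP uf]; rewrite mulgr1 //= -mulrA uf.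
have comm1 x y : x \in A_ 1%g -> y \in A_ 1%g -> x * y = y * x.
  by move=> x1 _; apply: neutral_central.
have [v] := common_eigenvector_in comm1 BI I0.
rewrite IE => /andP[v1 /eqP vf] [v0 eigv].
have [chi chiE] := eigenvector_sim v1 v0 eigv.
by move: v0; rewrite -vf -(neutral_central v f1) chiE // chi_f scale0r eqxx.
Qed.

Lemma lam_sum_sims (s : seq (Sim X)) y :
  uniq s -> (forall chi, chi \in s) -> y \in A_ 1%g ->
  lam y = \sum_(chi <- s) sim_val chi y / sim_val chi (vsval (alpha_chi chi)).
Proof.
move=> us s_all y1; rewrite -{1}[y]mulr1 -(sum_idem us s_all) mulr_sumr lam_sum.
by apply: eq_bigr => chi _; rewrite mulr_idem // lamZ lam_idem.
Qed.

(** * The action of [G] on characters and idempotents *)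

Lemma crossed_act_neutral g x : x \in A_ 1%g -> crossed_act X g x \in A_ 1%g.
Proof. by move/(act_grade g); rewrite conj1g. Qed.

Lemma sim_val_act g chi x : x \in A_ 1%g ->
  sim_val (sim_act g chi) x = sim_val chi (crossed_act X g^-1 x).
Proof.
move=> x1; rewrite /sim_val /= comp_lfunE /= lfunE /=.
by rewrite /act_neutral_fun vsprojK.
Qed.

Lemma sim_act1 chi : sim_act 1%g chi = chi.
Proof. by apply: sim_eq => x x1; rewrite sim_val_act // invg1 Defs.act1. Qed.

Lemma sim_actM g h chi : sim_act (g * h)%g chi = sim_act g (sim_act h chi).
Proof.
apply: sim_eq => x x1; rewrite !sim_val_act ?crossed_act_neutral //.
by rewrite invMg Defs.actM.
Qed.

Lemma sim_actV g chi : sim_act g chi = chi -> sim_act g^-1%g chi = chi.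
Proof. by move=> gchi; rewrite -{1}gchi -sim_actM mulVg sim_act1. Qed.

(** The stabilizer of [chi] is a subgroup, so it contains the group generated by [S] once it
    contains [S]. *)
Lemma sim_fix_gen (S : {set gT}) chi :
  sim_fix X <<S>>%g chi <-> forall g, g \in S -> sim_act g chi = chi.
Proof.
split=> [fixS g gS | fixS]; first exact/fixS/mem_gen.
pose H := [set g | `[< sim_act g chi = chi >]]%SET.
have group_H : group_set H.
  apply/group_setP; split=> [|g h]; first by rewrite !inE; apply: sim_act1.
  by rewrite !inE => gchi hchi; rewrite sim_actM hchi.
have /fintype.subsetP SH : (<<S>> \subset group group_H)%g.
  by rewrite gen_subG; apply/fintype.subsetP => g gS; rewrite !inE; apply: fixS.
by move=> g /SH; rewrite !inE.
Qed.

Lemma mulr_act_idem g chi x : x \in A_ 1%g ->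
  x * crossed_act X g (idem chi)
  = sim_val (sim_act g chi) x *: crossed_act X g (idem chi).
Proof.
move=> x1; rewrite sim_val_act // -linearZ -mulr_idem ?crossed_act_neutral //.
by rewrite rmorphM /= -Defs.actM mulgV Defs.act1.
Qed.

(** The product of [idem chi] and its image under [g] equals each factor, since each acts on the
    other with eigenvalue 1. *)
Lemma act_idem_fixed g chi :
  sim_act g chi = chi -> crossed_act X g (idem chi) = idem chi.
Proof.
move=> gchi; have e1 := idem_neutral chi; have ge1 := crossed_act_neutral g e1.
rewrite -[LHS]scale1r -(sim_val_idem chi) -{1}gchi.
rewrite -(mulr_act_idem g chi e1) (neutral_central _ e1) mulr_idem //.
by rewrite -{1}[g]invgK -sim_val_act // sim_actV // sim_val_idem ?scale1r.
Qed.

Lemma idem_mul_act g chi :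
  sim_act g chi <> chi -> idem chi * crossed_act X g (idem chi) = 0.
Proof.
move=> /eqP gchi; rewrite mulr_act_idem ?idem_neutral //.
by rewrite sim_val_idem_neq ?scale0r // eq_sym.
Qed.

(** With e = [idem chi], crossed commutativity and centrality give
    [a e = a e e = g(e) a e = g(e) e a], and e and g(e) are orthogonal. *)
Lemma mulr_idem_unfixed g chi a :
  sim_act g chi <> chi -> a \in A_ g -> a * idem chi = 0.
Proof.
move=> gchi ag; rewrite -idem_id mulrA (crossedC _ ag) -mulrA.
rewrite -(idem_central chi) mulrA.
by rewrite -(idem_central chi) ?mulrA idem_mul_act ?mul0r.
Qed.

(** Here strictness enters. If [A_g] killed e = [idem chi], then [beta a m = beta a (e m) = beta (a
    e) m = 0], so the identity and the zero map would both factor [beta] through the tensor product,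
    against uniqueness. *)
Lemma grade_mul_idem_neq0 g chi : strict X -> sim_act g chi = chi ->
  exists2 a, a \in A_ g & a * idem chi != 0.
Proof.
move=> Xstrict /(Xstrict g chi)[beta [[[beta_l beta_r beta_m] univ] _]].
apply: contrapT => none.
pose e := vsproj (neutral X) (idem chi).
have eE : vsval e = idem chi by rewrite vsprojK ?idem_neutral.
have beta0 (a : subvs_of (A_ g)) m : beta a m = 0.
  have -> : m = sim_module chi e m.
    rewrite /sim_module; have -> : chi e = 1 by have := sim_val_idem chi.
    by rewrite mul1r.
  rewrite -beta_m /rmul_grade eE.
  have -> : vsval a * idem chi = 0.
    apply: contrapT => /eqP ae0; apply: none.
    by exists (vsval a); rewrite ?subvsP.
  rewrite linear0; have := beta_l m (-1) 0 0.
  by rewrite scaler0 addr0 scaleN1r addNr.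
have [h [_ h_uniq]] := univ _ beta (And3 beta_l beta_r beta_m).
have h_id := h_uniq idfun (fun _ _ => erefl).
have h_0 := h_uniq \0 (fun (b : subvs_of (A_ g)) m => esym (beta0 b m)).
by have := oner_neq0 R[i]; rewrite (h_id 1 : 1 = h 1) -(h_0 1) eqxx.
Qed.

(** * Twisted characters and the lines [A_g e_chi] *)

Variables (Xstrict : strict X) (tw : twisted_choice X).
Local Notation tc := (twisted_char tw).

Lemma tcP chi g (c : R[i]) a b :
  tc chi g (c *: a + b) = c * tc chi g a + tc chi g b.
Proof. by rewrite /twisted_char /tw_val !linearP. Qed.

Lemma tcZ chi g (c : R[i]) a : tc chi g (c *: a) = c * tc chi g a.
Proof. by rewrite /twisted_char /tw_val !linearZ. Qed.

Lemma tcB chi g a b : tc chi g (a - b) = tc chi g a - tc chi g b.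
Proof. by rewrite /twisted_char /tw_val !linearB. Qed.

Lemma tc_mulV chi g a b : sim_act g chi = chi ->
  a \in A_ g -> b \in A_ g^-1%g ->
  tc chi g a * tc chi g^-1%g b = sim_val chi (a * b).
Proof. by move=> gchi ag bg; have := tw_inv tw gchi ag bg. Qed.

Lemma tc1 chi x : x \in A_ 1%g -> tc chi 1%g x = sim_val chi x.
Proof.
move=> x1; rewrite -{1}[x](vsprojK (U := neutral X)) //.
exact: tw_extends (sim_act1 chi) _.
Qed.

Lemma gradeMV g a b : a \in A_ g -> b \in A_ g^-1%g -> a * b \in A_ 1%g.
Proof. by move=> ag bg; rewrite -(mulgV g); apply: gradeM. Qed.

Lemma mul_idem_grade g chi a : a \in A_ g -> a * idem chi \in A_ g.
Proof. by move=> ag; rewrite -(mulg1 g) gradeM ?idem_neutral. Qed.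

(** The compatibility of [chi^g] with [chi^(g^-1)] gives [chi(a * star a) = 0], so [a * idem chi]
    times its star vanishes and positivity applies. *)
Lemma tc_eq0_mul_idem chi g a : sim_act g chi = chi ->
  a \in A_ g -> tc chi g a = 0 -> a * idem chi = 0.
Proof.
move=> gchi ag tca; apply: mul_star_eq0; have sag := star_gradeV ag.
have aa_e : a * star a * idem chi = 0.
  by rewrite mulr_idem ?(gradeMV ag) // -(tc_mulV gchi ag) // tca mul0r scale0r.
rewrite starM mulrA -(mulrA a).
(* Trading the star of the idempotent for a scalar leaves [a * star a * idem chi], already known to
   be 0. *)
have -> : idem chi * star (idem chi)
    = sim_val chi (star (idem chi)) *: idem chi.
  by rewrite idem_central mulr_idem ?star_neutral ?idem_neutral.
by rewrite -scalerAr -scalerAl -mulrA idem_central mulrA aa_e scaler0.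
Qed.

(** Multiply by [chi^(g^-1)(b)], nonzero for a suitable [b] by strictness: both sides become
    [chi(a * b)]. *)
Lemma tc_mul_idem chi g a : sim_act g chi = chi ->
  a \in A_ g -> tc chi g (a * idem chi) = tc chi g a.
Proof.
move=> gchi ag; have gVchi := sim_actV gchi.
have [b bg be] := grade_mul_idem_neq0 Xstrict gVchi.
have tcb : tc chi g^-1%g b != 0.
  by apply: contra_neq be => /tc_eq0_mul_idem; apply.
apply: (mulIf tcb); rewrite !tc_mulV ?mul_idem_grade //.
rewrite -mulrA idem_central mulrA sim_valM ?idem_neutral ?(gradeMV ag) //.
by rewrite sim_val_idem mulr1.
Qed.

(* A_g e_chi is a line: u_g is its generator normalized by chi^g (u_g) = 1. *)
Definition tw_unit chi g : A :=
  xget 0 [set u | [/\ u \in A_ g, tc chi g u = 1 & u * idem chi = u]].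

Lemma tw_unitP chi g : sim_act g chi = chi ->
  [/\ tw_unit chi g \in A_ g, tc chi g (tw_unit chi g) = 1
    & tw_unit chi g * idem chi = tw_unit chi g].
Proof.
move=> gchi; apply: (@xgetPex _ 0
  [set u | [/\ u \in A_ g, tc chi g u = 1 & u * idem chi = u]]).
have [a ag ae] := grade_mul_idem_neq0 Xstrict gchi.
have tca : tc chi g a != 0.
  by apply: contra_neq ae => /tc_eq0_mul_idem; apply.
exists ((tc chi g a)^-1 *: (a * idem chi)); split.
- by rewrite memvZ ?mul_idem_grade.
- by rewrite tcZ tc_mul_idem // mulVf.
- by rewrite -scalerAl -mulrA idem_id.
Qed.

Lemma tw_unit_grade chi g : sim_act g chi = chi -> tw_unit chi g \in A_ g.
Proof. by case/tw_unitP. Qed.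

Lemma tc_tw_unit chi g : sim_act g chi = chi -> tc chi g (tw_unit chi g) = 1.
Proof. by case/tw_unitP. Qed.

Lemma tw_unit_idem chi g :
  sim_act g chi = chi -> tw_unit chi g * idem chi = tw_unit chi g.
Proof. by case/tw_unitP. Qed.

(** The difference of [a] and [chi^g(a) *: tw_unit chi g] is killed by [chi^g], hence by
    [idem chi]. *)
Lemma mul_idem_tw_unit chi g a : sim_act g chi = chi -> a \in A_ g ->
  a * idem chi = tc chi g a *: tw_unit chi g.
Proof.
move=> gchi ag; have [ug tcu ue] := tw_unitP gchi.
apply/eqP; rewrite -subr_eq0 -{1}ue scalerAl -mulrBl; apply/eqP.
apply: tc_eq0_mul_idem gchi _ _; first by rewrite memvB ?memvZ.
by rewrite tcB tcZ tcu mulr1 subrr.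
Qed.

Lemma tw_unitV chi g : sim_act g chi = chi ->
  tw_unit chi g * tw_unit chi g^-1%g = idem chi.
Proof.
move=> gchi; have [ug tcu ue] := tw_unitP gchi.
have [vg tcv ve] := tw_unitP (sim_actV gchi).
rewrite -ve mulrA mulr_idem ?(gradeMV ug) // -(tc_mulV gchi ug) //.
by rewrite tcu tcv mulr1 scale1r.
Qed.

(** * Products of the generators [u_g] and the scalar [phi_chi] *)

Definition fixes_all chi (gs : seq gT) :=
  forall g, g \in gs -> sim_act g chi = chi.

(** The trailing idempotent makes the empty product the unit of the ideal [A e_chi], so that
    concatenation becomes multiplication. *)
Definition tw_units chi (gs : seq gT) : A :=
  \prod_(g <- gs) tw_unit chi g * idem chi.

Lemma fixes_all_cons chi g gs :
  fixes_all chi (g :: gs) -> sim_act g chi = chi /\ fixes_all chi gs.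
Proof.
move=> fix_gs; split=> [|h hgs]; apply: fix_gs; first exact: mem_head.
by rewrite in_cons hgs orbT.
Qed.

Lemma fixes_all_prod chi gs :
  fixes_all chi gs -> sim_act (\prod_(g <- gs) g)%g chi = chi.
Proof.
elim: gs => [|g gs IH]; first by rewrite big_nil sim_act1.
by case/fixes_all_cons=> gchi /IH gschi; rewrite big_cons sim_actM gschi.
Qed.

Lemma tw_units_nil chi : tw_units chi [::] = idem chi.
Proof. by rewrite /tw_units big_nil mul1r. Qed.

Lemma tw_units_cons chi g gs :
  tw_units chi (g :: gs) = tw_unit chi g * tw_units chi gs.
Proof. by rewrite /tw_units big_cons mulrA. Qed.

Lemma tw_units_cat chi gs hs :
  tw_units chi (gs ++ hs) = tw_units chi gs * tw_units chi hs.
Proof.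
rewrite /tw_units big_cat /= -!mulrA; congr (_ * _).
by rewrite [RHS]mulrA idem_central -mulrA idem_id.
Qed.

Lemma tw_units_idem chi gs : tw_units chi gs * idem chi = tw_units chi gs.
Proof. by rewrite /tw_units -mulrA idem_id. Qed.

Lemma tw_units_grade chi gs :
  fixes_all chi gs -> tw_units chi gs \in A_ (\prod_(g <- gs) g)%g.
Proof.
elim: gs => [|g gs IH]; first by rewrite tw_units_nil big_nil idem_neutral.
case/fixes_all_cons=> gchi /IH gs_in.
by rewrite tw_units_cons big_cons gradeM ?tw_unit_grade.
Qed.

(** Multiplying on the left by [u_(g^-1)] strips the first factor [u_g]. *)
Lemma tw_units_neq0 chi gs : fixes_all chi gs -> tw_units chi gs != 0.
Proof.
elim: gs => [|g gs IH]; first by rewrite tw_units_nil idem_neq0.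
case/fixes_all_cons=> gchi /IH; apply: contra_neq; rewrite tw_units_cons => u0.
have := tw_unitV (sim_actV gchi); rewrite invgK => ue.
by rewrite -tw_units_idem -idem_central -ue -mulrA u0 mulr0.
Qed.

(** When all of [gs] fix [chi], this is the coefficient of [tw_units chi gs] on the generator [u] of
    its degree, where the twisted character is 1. *)
Definition tw_scalar chi gs : R[i] :=
  tc chi (\prod_(g <- gs) g)%g (tw_units chi gs).

Lemma tw_scalar_neq0 chi gs : fixes_all chi gs -> tw_scalar chi gs != 0.
Proof.
move=> fix_gs; apply: contra_neq (tw_units_neq0 fix_gs) => k0.
have gs_in := tw_units_grade fix_gs.
rewrite -tw_units_idem (mul_idem_tw_unit (fixes_all_prod fix_gs) gs_in).
by rewrite [tc _ _ _]k0 scale0r.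
Qed.

Lemma prod_grade (s : seq (gT * A)) : (forall p, p \in s -> p.2 \in A_ p.1) ->
  \prod_(p <- s) p.2 \in A_ (\prod_(p <- s) p.1)%g.
Proof.
elim: s => [|p s IH] s_in; first by rewrite !big_nil grade1.
rewrite !big_cons gradeM ?s_in ?mem_head // IH // => q qs.
by rewrite s_in // in_cons qs orbT.
Qed.

Lemma prod_mul_idem chi (s : seq (gT * A)) :
  fixes_all chi [seq p.1 | p <- s] -> (forall p, p \in s -> p.2 \in A_ p.1) ->
  \prod_(p <- s) p.2 * idem chi
  = (\prod_(p <- s) tc chi p.1 p.2) *: tw_units chi [seq p.1 | p <- s].
Proof.
elim: s => [|p s IH] /=; first by rewrite !big_nil tw_units_nil mul1r scale1r.
case/fixes_all_cons=> pchi fix_s s_in; rewrite !big_cons tw_units_cons -mulrA.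
rewrite IH // => [|q qs]; last by rewrite s_in // in_cons qs orbT.
rewrite -scalerAr -[tw_units _ _ in LHS]tw_units_idem -idem_central mulrA.
rewrite (mul_idem_tw_unit pchi (s_in p (mem_head _ _))).
by rewrite -scalerAl scalerA mulrC.
Qed.

(** The inverse scalar satisfies the condition defining [phi_chi], and the condition has only one
    solution. *)
Lemma phi_chiE chi gs : fixes_all chi gs ->
  phi_chi tw chi gs = (tw_scalar chi gs)^-1.
Proof.
move=> fix_gs; rewrite /phi_chi; set S := [set c | _].
have kN0 := tw_scalar_neq0 fix_gs.
have tc_prod s : [seq p.1 | p <- s] = gs ->
    (forall p, p \in s -> p.2 \in A_ p.1) ->
    tc chi (\prod_(p <- s) p.1)%g (\prod_(p <- s) p.2)
    = (\prod_(p <- s) tc chi p.1 p.2) * tw_scalar chi gs.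
  move=> sE s_in.
  have pE : (\prod_(p <- s) p.1 = \prod_(g <- gs) g)%g by rewrite -sE big_map.
  rewrite -tc_mul_idem ?prod_grade //; last by rewrite pE fixes_all_prod.
  by rewrite prod_mul_idem ?sE // tcZ pE.
have S_inv : S (tw_scalar chi gs)^-1.
  split=> [|s sE s_in]; first by rewrite invr_eq0.
  by rewrite tc_prod // mulrC mulfK.
have [c_neq0 cE] : S (xget 1 S) by apply: xgetPex; exists (tw_scalar chi gs)^-1.
(* Uniqueness: on the generators [u_g] all twisted characters are 1, so the defining identity
   determines the scalar. *)
pose s := [seq (g, tw_unit chi g) | g <- gs].
have sE : [seq p.1 | p <- s] = gs by rewrite -map_comp map_id.
have s_in p : p \in s -> p.2 \in A_ p.1.
  by case/mapP=> g ggs ->; apply/tw_unit_grade/fix_gs.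
have tc_s : \prod_(p <- s) tc chi p.1 p.2 = 1.
  by rewrite big_map big_seq big1 // => g ggs; apply/tc_tw_unit/fix_gs.
have := cE s sE s_in; rewrite tc_prod // tc_s mul1r => ck1.
by apply: (mulIf kN0); rewrite -ck1 mulVf.
Qed.

(** * The component of [Omega_gh] at a character *)

Local Notation alpha chi := (sim_val chi (vsval (alpha_chi chi))).

(** Both sides represent [chi^g] on [A_g]: [lam (y * u_(g^-1))] is [chi^g(y) * lam (idem chi)], and
    [lam (idem chi)] is the inverse of [alpha chi]. *)
Lemma tw_dual_basis_sum chi g : sim_act g chi = chi ->
  \sum_(x <- P g) tc chi g x *: star x = alpha chi *: tw_unit chi g^-1%g.
Proof.
move=> gchi; have [vg tcv ve] := tw_unitP (sim_actV gchi).
apply/eqP; rewrite -subr_eq0; apply/eqP.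
apply: (@lam_nondegenerate g) => [|y yg].
  by rewrite memvB ?memvZ ?(dual_basis_sum_in _ (onP g)).
rewrite mulrBr addrC -scalerAr -scaleNr lamP.
rewrite (lam_dual_basis_sum (onP g)) //; last exact: tcP.
rewrite -ve mulrA mulr_idem ?(gradeMV yg) // -(tc_mulV gchi yg) // tcv mulr1.
by rewrite lamZ lam_idem mulrCA mulNr mulfV ?sim_alpha_neq0 // mulrN1 addNr.
Qed.

Lemma OmegaE g h chi : Omega_gh X P g h * idem chi =
  \sum_(x <- P g) (x * idem chi) * crossed_act X h (star x).
Proof.
rewrite /Omega_gh mulr_suml; apply: eq_bigr => x _.
by rewrite -mulrA -idem_central mulrA.
Qed.

Lemma Omega_idem_unfixedl g h chi :
  sim_act g chi <> chi -> Omega_gh X P g h * idem chi = 0.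
Proof.
move=> gchi; rewrite OmegaE big_seq big1 // => x xP.
by rewrite (mulr_idem_unfixed gchi) ?mul0r ?(basis_mem (proj1 (onP g))).
Qed.

(** Each [x * idem chi] is [chi^g(x) *: u_g]; the scalars move into the argument of [h], where the
    Riesz sum appears. *)
Lemma Omega_idem_fixedl g h chi : sim_act g chi = chi ->
  Omega_gh X P g h * idem chi
  = alpha chi *: (tw_unit chi g * crossed_act X h (tw_unit chi g^-1%g)).
Proof.
move=> gchi; rewrite OmegaE scalerAr -linearZ -tw_dual_basis_sum //.
rewrite linear_sum mulr_sumr big_seq [RHS]big_seq; apply: eq_bigr => x xP.
rewrite (mul_idem_tw_unit gchi) ?(basis_mem (proj1 (onP g))) //.
by rewrite /= linearZ -scalerAl -scalerAr.
Qed.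

(** Between [u_g] and [h(u_(g^-1))] one can insert [idem chi] times its image under [h], which is
    0. *)
Lemma Omega_idem_unfixedr g h chi :
  sim_act h chi <> chi -> Omega_gh X P g h * idem chi = 0.
Proof.
move=> hchi; case: (eqVneq (sim_act g chi) chi) => [gchi | /eqP gchi];
  last exact: Omega_idem_unfixedl.
rewrite Omega_idem_fixedl // -(tw_unit_idem gchi).
rewrite -(tw_unit_idem (sim_actV gchi)) -(idem_central _ (tw_unit _ g^-1%g)).
rewrite rmorphM /=.
by rewrite -mulrA (mulrA (idem chi)) idem_mul_act // mul0r mulr0 scaler0.
Qed.

(** Crossed commutativity turns [u_h u_(g^-1) u_(h^-1)] into [h(u_(g^-1)) u_h u_(h^-1)], and the
    last two factors give the idempotent, which [h] fixes. *)
Lemma Omega_idem_fixed g h chi : sim_act g chi = chi -> sim_act h chi = chi ->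
  Omega_gh X P g h * idem chi
  = alpha chi *: tw_units chi [:: g; h; g^-1; h^-1]%g.
Proof.
move=> gchi hchi; rewrite Omega_idem_fixedl //; congr (_ *: _).
rewrite !tw_units_cons tw_units_nil (tw_unit_idem (sim_actV hchi)).
congr (_ * _); rewrite mulrA (crossedC _ (tw_unit_grade hchi)) -mulrA.
rewrite tw_unitV // -(act_idem_fixed hchi) -rmorphM /=.
by rewrite tw_unit_idem ?sim_actV.
Qed.

Lemma Omega_grade g h : Omega_gh X P g h \in A_ (comm_gh g h).
Proof.
rewrite /Omega_gh big_seq; apply: memv_suml => x xP.
have -> : comm_gh g h = (g * (g^-1 ^ h^-1))%g.
  by rewrite /comm_gh conjgE invgK !mulgA.
have xg : x \in A_ g := basis_mem (proj1 (onP g)) xP.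
exact: gradeM xg (act_grade h (star_gradeV xg)).
Qed.

(** * The component of the whole product at a character *)

Lemma prod_mul_idem_eq0 (I : eqType) (s : seq I) (F : I -> A) chi i : i \in s ->
  F i * idem chi = 0 -> \prod_(j <- s) F j * idem chi = 0.
Proof.
move=> + Fi0; elim: s => // j s IH; rewrite in_cons big_cons.
case/orP=> [/eqP <- | /IH s0].
  by rewrite -mulrA -idem_central mulrA Fi0 mul0r.
by rewrite -mulrA s0 mulr0.
Qed.

Lemma prod_Omega_idem (I : Type) (s : seq I) (g h : I -> gT) chi :
  (forall i, sim_act (g i) chi = chi) -> (forall i, sim_act (h i) chi = chi) ->
  \prod_(i <- s) Omega_gh X P (g i) (h i) * idem chi
  = alpha chi ^+ size s *:
    tw_units chi (flatten [seq [:: g i; h i; (g i)^-1; (h i)^-1]%g | i <- s]).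
Proof.
move=> gchi hchi; elim: s => [|i s IH].
  by rewrite big_nil expr0 scale1r mul1r tw_units_nil.
rewrite big_cons -mulrA IH -scalerAr [size _]/= exprS.
rewrite -[tw_units _ _ in LHS]tw_units_idem -idem_central mulrA.
rewrite Omega_idem_fixed // -scalerAl scalerA mulrC.
congr (_ *: _); exact/esym/tw_units_cat.
Qed.

Lemma prod_Omega_neutral (r s : nat) (g h : 'I_r -> gT) (m : 'I_s -> gT)
    (a : 'I_s -> A) :
  (forall j, a j \in A_ (m j)) ->
  ((\prod_(i < r) comm_gh (g i) (h i)) * \prod_(j < s) m j = 1)%g ->
  (\prod_(i < r) Omega_gh X P (g i) (h i)) * (\prod_(j < s) a j) \in A_ 1%g.
Proof.
move=> am <-; rewrite gradeM //.
  elim/big_rec2: _ => [|i b k _ bk]; first exact: grade1.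
  exact: gradeM (Omega_grade _ _) bk.
elim/big_rec2: _ => [|i b k _ bk]; first exact: grade1.
exact: gradeM (am i) bk.
Qed.

Lemma sim_val_prod_fixed (r s : nat) (g h : 'I_r -> gT) (m : 'I_s -> gT)
    (a : 'I_s -> A) chi :
  (forall j, a j \in A_ (m j)) ->
  ((\prod_(i < r) comm_gh (g i) (h i)) * \prod_(j < s) m j = 1)%g ->
  (forall i, sim_act (g i) chi = chi) -> (forall i, sim_act (h i) chi = chi) ->
  (forall j, sim_act (m j) chi = chi) ->
  sim_val chi ((\prod_(i < r) Omega_gh X P (g i) (h i)) * \prod_(j < s) a j)
  = alpha chi ^+ r * (\prod_(j < s) tc chi (m j) (a j))
    / phi_chi tw chi
         (flatten [seq [:: g i; h i; (g i)^-1; (h i)^-1]%g | i : 'I_r]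
            ++ [seq m j | j : 'I_s]).
Proof.
move=> am rel1 gchi hchi mchi.
set gs := flatten _; set ms := [seq m j | j : _]; set y := _ * _.
have fix_gs : fixes_all chi (gs ++ ms).
  move=> k; rewrite mem_cat.
  case/orP=> [/flattenP[l /mapP[i _ ->]] | /mapP[j _ ->] //].
  rewrite !inE => /or4P[] /eqP -> //; exact: sim_actV.
have prod1 : (\prod_(k <- gs ++ ms) k = 1)%g.
  rewrite -[RHS]rel1 big_cat /=; congr (_ * _)%g.
    rewrite big_flatten big_map big_enum_type /=; apply: eq_bigr => i _.
    by rewrite !big_cons big_nil mulg1 !mulgA.
  by rewrite big_map big_enum_type.
have y1 : y \in A_ 1%g by apply: prod_Omega_neutral.
have yE : y * idem chi = (alpha chi ^+ r * \prod_(j < s) tc chi (m j) (a j)) *: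
    tw_units chi (gs ++ ms).
  pose p := [seq (m j, a j) | j : 'I_s].
  have pE : [seq q.1 | q <- p] = ms by rewrite -map_comp.
  have p_in q : q \in p -> q.2 \in A_ q.1 by case/mapP=> j _ ->; apply: am.
  have fix_ms : fixes_all chi [seq q.1 | q <- p].
    by rewrite pE => k /mapP[j _ ->].
  have -> : y = \prod_(i <- enum 'I_r) Omega_gh X P (g i) (h i) *
      \prod_(q <- p) q.2.
    by rewrite big_enum_type; congr (_ * _); rewrite big_map big_enum_type.
  (* The idempotent evaluates the [a j] first; the units they leave behind return a copy of it for
     the [Omega_gh] factors. *)
  rewrite -mulrA (prod_mul_idem fix_ms p_in) -[tw_units _ _]tw_units_idem.
  rewrite -idem_central -scalerAr mulrA prod_Omega_idem // -scalerAl scalerA.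
  by rewrite -cardE card_ord pE -tw_units_cat big_map big_enum_type mulrC.
have := sim_valM chi y1 (idem_neutral chi); rewrite sim_val_idem mulr1 => <-.
rewrite yE sim_valZ phi_chiE // invrK; congr (_ * _).
(* All degrees multiply to 1, so the scalar is read off by [chi^1 = chi]. *)
rewrite /tw_scalar prod1 tc1 // -prod1; exact: tw_units_grade.
Qed.

Lemma prod_Omega_idem_unfixed (r s : nat) (g h : 'I_r -> gT) (m : 'I_s -> gT)
    (a : 'I_s -> A) chi :
  (forall j, a j \in A_ (m j)) ->
  ~ [/\ forall i, sim_act (g i) chi = chi, forall i, sim_act (h i) chi = chi
      & forall j, sim_act (m j) chi = chi] ->
  (\prod_(i < r) Omega_gh X P (g i) (h i)) * (\prod_(j < s) a j) * idem chi = 0.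
Proof.
move=> am /not_and3P[] /existsNP[i ni]; rewrite -mulrA.
- rewrite -idem_central mulrA (prod_mul_idem_eq0 (mem_index_enum i)) ?mul0r //.
  exact: Omega_idem_unfixedl.
- rewrite -idem_central mulrA (prod_mul_idem_eq0 (mem_index_enum i)) ?mul0r //.
  exact: Omega_idem_unfixedr.
rewrite (prod_mul_idem_eq0 (mem_index_enum i)) ?mulr0 //.
exact: mulr_idem_unfixed ni (am i).
Qed.

End PrincipalComponent.

Theorem corollary4p15 (R : realType) (gT : finGroupType) (A : falgType R[i])
    (X : crossed_frobenius_star gT A) (Xstrict : strict X)
    (tw : twisted_choice X)
    (P : gT -> seq A) (onP : forall g, orthonormal_basis X (grade X g) (P g))
    (r s : nat) (g h : 'I_r -> gT) (m : 'I_s -> gT)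
    (rel1 : ((\prod_(i < r) comm_gh (g i) (h i)) * \prod_(j < s) m j = 1)%g)
    (a : 'I_s -> A) (am : forall j, a j \in grade X (m j)) :
  lambda X ((\prod_(i < r) Omega_gh X P (g i) (h i)) * \prod_(j < s) a j) =
  \sum_(chi \in sim_fix X
      <<[set x in codom g ++ codom h ++ codom m]>>%g)
    ((chi (alpha_chi chi) : R[i]) ^ (r%:Z - 1)
       * (\prod_(j < s) twisted_char tw chi (m j) (a j))
     / phi_chi tw chi
         (flatten [seq [:: g i; h i; (g i)^-1; (h i)^-1]%g | i : 'I_r]
            ++ [seq m j | j : 'I_s])).
Proof.
have [sims us sims_all] := sim_enumeration onP.
rewrite -[lambda X _]/(lam X _).
rewrite (lam_sum_sims onP us sims_all (prod_Omega_neutral onP am rel1)).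
(* Both sides become sums over all characters, the right one with value 0 off the fixed set, and are
   compared termwise. *)
rewrite fsbig_mkcond (fsbigE sims) //; last by move=> chi _; rewrite sims_all.
rewrite [RHS]big_mkcond; apply: eq_bigr => chi _.
rewrite in_setT /functions.patch.
set y := _ * \prod_(j < s) a j; set K := sim_fix X _.
have y1 : y \in grade X 1%g by apply: (prod_Omega_neutral onP am rel1).
have KE : K chi <-> [/\ forall i, sim_act (g i) chi = chi,
    forall i, sim_act (h i) chi = chi & forall j, sim_act (m j) chi = chi].
  rewrite /K sim_fix_gen; split=> [fixS | [gchi hchi mchi] k].
    by split=> i; apply: fixS; rewrite inE !mem_cat codom_f ?orbT.
  by rewrite inE !mem_cat => /or3P[] /codomP[i ->].
case: ifPn => [/set_mem/KE[gchi hchi mchi] | /negP chiK].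
  rewrite (sim_val_prod_fixed onP Xstrict tw am rel1) //.
  have al0 := sim_alpha_neq0 onP chi.
  have -> : chi (alpha_chi chi) = sim_val chi (vsval (alpha_chi chi)).
    by rewrite /sim_val vsvalK.
  (* For [r = 0] the exponent is -1; splitting the integer power relies on [al0]. *)
  rewrite expfzDr // exprN1 -exprnP.
  by rewrite -!mulrA; congr (_ * _); rewrite mulrA mulrC.
(* A character moved by some generator contributes [chi(y) = chi(y * idem chi) = 0]. *)
have /(congr1 (sim_val chi)) : y * idem chi = 0.
  apply: (prod_Omega_idem_unfixed onP Xstrict tw) => // fix_all; apply: chiK.
  by apply/mem_set/KE.
rewrite (sim_valM _ y1) ?idem_neutral // (sim_val_idem onP) mulr1.
rewrite sim_val0 => ->.
by rewrite mul0r.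
Qed.
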